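(* Let $X=\{0\}\times[0,1]\subset\mathbb{R}^2$ and let $\boldsymbol{\xi},\boldsymbol{\xi}^1,\boldsymbol{\xi}^2,\ldots$ be iid random variables on a complete probability space $(\Omega,\mathcal{F},\mathbb{P})$, each uniformly distributed on $\Xi=[0,1]$. There exist a Carathéodory function $g:\Xi\times\mathbb{R}^2\to\mathbb{R}$ and a sequence $\delta^\nu\in(0,1]$, $\nu\in\mathbb{N}$, with $\delta^\nu\downarrow0$, such that for $$f(\xi,x)=\max\{g(\xi,x),0\}+35\|x\|^2,\qquad (\xi,x)\in\Xi\times\mathbb{R}^2,$$ the following hold. (a) For any $\xi\in\Xi$, $g(\xi,\cdot)$ is $70$-Lipschitz and $70$-smooth (on $\mathbb{R}^2$), and $f(\xi,\cdot)$ is convex and is $140$-Lipschitz on $X$. (b) For any $x\in\mathbb{R}^2$, $|\mathbb{E}[f(\boldsymbol{\xi},x)]|<\infty$. (c) For any $\nu\in\mathbb{N}$, the set $D^\nu=\{x\in X\mid f(\xi,\cdot)\text{ is }C^1\text{ on }\mathbb{B}(x,\delta^\nu)\text{ for all }\xi\in\Xi\}$ is nonempty. (d) $\mathbb{P}$-almost surely, one has $$\liminf_{\nu\to\infty}\ \sup_{x\in D^\nu}\ \inf_{y,\hat y\in\mathbb{B}(x,\delta^\nu)}\Big\|\mathbb{E}[\nabla_x f(\boldsymbol{\xi},y)]-\frac1\nu\sum_{i=1}^\nu\nabla_x f(\boldsymbol{\xi}^i,\hat y)\Big\|\ \ge\ \frac12 .$$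
   Context: $\mathbb{N}=\{1,2,\ldots\}$. $\|\cdot\|$ is the Euclidean norm and $\mathbb{B}(x,r)=\{y\mid\|y-x\|\le r\}$ is the closed ball. A function $f:\Xi\times\mathbb{R}^d\to\mathbb{R}$ is Carathéodory if $f(\xi,\cdot)$ is continuous for each $\xi$ and $f(\cdot,x)$ is Borel measurable for each $x$. $\nabla_x f(\xi,y)$ is the gradient of $f(\xi,\cdot)$ at $y$. A function $h:\mathbb{R}^d\to\mathbb{R}$ is $L$-Lipschitz on $X$ if $|h(x)-h(y)|\le L\|x-y\|$ for all $x,y\in X$ (simply $L$-Lipschitz when $X=\mathbb{R}^d$); it is $L$-smooth if it is continuously differentiable with $L$-Lipschitz gradient. ''$f(\xi,\cdot)$ is $C^1$ on $\mathbb{B}(x,\delta)$'' means that $f(\xi,\cdot)$ is differentiable at every point of $\mathbb{B}(x,\delta)$ and $\nabla_x f(\xi,\cdot)$ is continuous on $\mathbb{B}(x,\delta)$. ''$\mathbb{P}$-almost surely'' means for all $\omega$ in a set of $\mathbb{P}$-probability one (the probability space is complete). *)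

(* Defs.v *)
From HB Require Import structures.
From mathcomp Require Import all_boot all_order all_algebra.
From mathcomp Require Import finmap.
From mathcomp Require Import all_classical all_reals all_analysis.

Set Implicit Arguments.
Unset Strict Implicit.
Unset Printing Implicit Defensive.

Import Order.TTheory GRing.Theory Num.Theory.
Import numFieldNormedType.Exports.

Local Open Scope classical_set_scope.
Local Open Scope ring_scope.

(* The library norm [`|x|] on ['rV[R]_n] is the sup norm, so the Euclidean norm
   is introduced separately. Both norms induce the same topology and the same
   differentials, so [continuous] and [differentiable] are used unchanged. *)
Definition enorm (R : realType) (n : nat) (x : 'rV[R]_n) : R :=
  Num.sqrt (\sum_(j < n) x 0 j ^+ 2).

Definition eball (R : realType) (n : nat) (x : 'rV[R]_n) (r : R)
    : set 'rV[R]_n :=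
  [set y | enorm (y - x) <= r].

Definition euclidean_lipschitz (R : realType) (n : nat) (L : R) (A : set 'rV[R]_n)
    (h : 'rV[R]_n -> R) : Prop :=
  forall x y, A x -> A y -> `|h x - h y| <= L * enorm (x - y).

(* Only meaningful at points of differentiability. *)
Definition gradient (R : realType) (n : nat) (h : 'rV[R]_n -> R)
    (y : 'rV[R]_n) : 'rV[R]_n :=
  \row_j 'D_(delta_mx 0 j) h y.

(* Differentiability is with respect to the whole space, also at boundary
   points of [A]; only the continuity of the gradient is relative to [A]. *)
Definition C1_on (R : realType) (n : nat) (A : set 'rV[R]_n)
    (h : 'rV[R]_n -> R) : Prop :=
  (forall y, A y -> differentiable h y) /\ {within A, continuous (gradient h)}.

Definition euclidean_smooth (R : realType) (n : nat) (L : R) (h : 'rV[R]_n -> R)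
    : Prop :=
  [/\ forall y, differentiable h y,
      continuous (gradient h) &
      forall x y, enorm (gradient h x - gradient h y) <= L * enorm (x - y)].

(* A function on [Xi * R^n] is represented by a total function on [R * R^n]
   of which only the values at [xi] in [Xi] matter. *)
Definition caratheodory (R : realType) (n : nat) (Xi : set R)
    (f : R -> 'rV[R]_n -> R) : Prop :=
  (forall xi, Xi xi -> continuous (f xi)) /\
  (forall x, measurable_fun Xi (f ^~ x)).

Definition mutually_independent (d : measure_display) (Omega : measurableType d)
    (R : realType) (P : probability Omega R) (I : choiceType)
    (X : I -> {RV P >-> R}) : Prop :=
  forall (J : {fset I}) (A : I -> set R), (forall i, measurable (A i)) ->
    P (\bigcap_(i in [set` J]) (X i @^-1` A i)) =
    (\prod_(i <- J) P (X i @^-1` A i))%E.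

(* Componentwise expectation of a random vector. [fine] replaces an infinite
   expectation by 0, so this is only meaningful for integrable components. *)
Definition mean_row (d : measure_display) (Omega : measurableType d)
    (R : realType) (P : probability Omega R) (n : nat)
    (V : Omega -> 'rV[R]_n) : 'rV[R]_n :=
  \row_(j < n) fine ('E_P[fun w => (V w 0 j)%R])%E.

Definition segX (R : realType) : set 'rV[R]_2 :=
  [set x | x 0 0 = 0 /\ 0 <= x 0 1 <= 1].

(* Main.v *)
(** The second axis is cut into disjoint blocks [[1/(k+2), 1/(k+1)]], each
    carrying a bump of quartic height, and [g xi x = x_0 + s(xi) * bump(x_1)],
    where on block [k] the sign [s(xi)] is positive exactly when [xi] lies in the
    [k]-th set of a countable family of finite unions of short intervals.  Near
    the midpoint of block [k] the bump dominates [x_0], so [max(g, 0)] has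
    first partial derivative [1] there if [xi] lies in the [k]-th set and [0]
    otherwise.  Any sample of size [nu] is covered by [nu] intervals of length
    [1 / (4 nu)], whose union has probability at most 1/4 and occurs as the
    [k]-th set for some [k] below a bound depending only on [nu]; at the
    corresponding midpoint the empirical mean of that derivative is [1] and its
    expectation at most [1/4], whatever the sample.  The radius [delta nu] is
    chosen small against the bump heights of the finitely many blocks used at
    size [nu]. *)

Require Import Defs.
From HB Require Import structures.
From mathcomp Require Import all_boot all_order all_algebra.
From mathcomp Require Import all_classical all_reals all_analysis.
From mathcomp Require Import measurable_realfun ring lra.

Set Implicit Arguments.
Unset Strict Implicit.
Unset Printing Implicit Defensive.

Import Order.TTheory GRing.Theory Num.Theory.
Import numFieldNormedType.Exports.

Local Open Scope classical_set_scope.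
Local Open Scope ring_scope.

(** * A single bump and its second-order estimates *)

Section Bump.
Variables (R : realType).
Implicit Types a b s t : R.

(** The square makes the derivative vanish at both endpoints too, so the extension by 0 is C^1 with
    Lipschitz derivative. *)
Definition bump a b t : R := if a <= t <= b then ((t - a) * (b - t)) ^+ 2 else 0.

Definition dbump a b t : R :=
  if a <= t <= b then 2 * ((t - a) * (b - t)) * (a + b - 2 * t) else 0.

(** With both points inside, the remainder is [(s - t) ^+ 2] times a bounded factor. With one point
    outside, the product of endpoint distances of the inner point is at most [|s - t|], because one
    distance is and the other is at most 1. *)
Lemma bump_taylor a b s t : a <= b <= a + 1 ->
  `|bump a b s - bump a b t - dbump a b t * (s - t)| <= 3 * (s - t) ^+ 2.
Proof.
move=> /andP[ab b1]; rewrite /bump /dbump ler_norml.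
case: ifPn => [/andP[as_ sb]|sab]; case: ifPn => [/andP[at_ tb]|tab].
- have -> : ((s - a) * (b - s)) ^+ 2 - ((t - a) * (b - t)) ^+ 2 -
      2 * ((t - a) * (b - t)) * (a + b - 2 * t) * (s - t) =
      (s - t) ^+ 2 * ((a + b - s - t) ^+ 2 - 2 * ((t - a) * (b - t))) by ring.
  have h1 : 0 <= (t - a) * (b - t) by apply: mulr_ge0; lra.
  have h2 : (t - a) * (b - t) <= 1 by nra.
  have h3 : (a + b - s - t) ^+ 2 <= 1 by nra.
  have h4 : 0 <= (s - t) ^+ 2 by apply: sqr_ge0.
  have h5 : 0 <= (a + b - s - t) ^+ 2 by apply: sqr_ge0.
  by apply/andP; split; nra.
- rewrite subr0 mul0r subr0.
  have h1 : 0 <= (s - a) * (b - s) by apply: mulr_ge0; lra.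
  have h4 : 0 <= (s - t) ^+ 2 by apply: sqr_ge0.
  have h2 : ((s - a) * (b - s)) ^+ 2 <= (s - t) ^+ 2.
    rewrite -[leRHS](real_normK (num_real _)) lerXn2r ?nnegrE//.
    have [ta|at_] := ltP t a.
      by rewrite ger0_norm; nra.
    have bt : b < t by rewrite ltNge; apply: contra tab => tb; rewrite at_.
    by rewrite ler0_norm; nra.
  by apply/andP; split; nra.
- rewrite sub0r.
  have h1 : 0 <= (t - a) * (b - t) by apply: mulr_ge0; lra.
  have h4 : 0 <= (s - t) ^+ 2 by apply: sqr_ge0.
  have h2 : (t - a) * (b - t) <= `|s - t|.
    have [sa|as_] := ltP s a; first by rewrite ler0_norm; nra.
    have bs : b < s by rewrite ltNge; apply: contra sab => sb; rewrite as_.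
    by rewrite ger0_norm; nra.
  have h3 : ((t - a) * (b - t)) ^+ 2 <= (s - t) ^+ 2.
    by rewrite -[leRHS](real_normK (num_real _)) lerXn2r ?nnegrE.
  have h5 : `|2 * ((t - a) * (b - t)) * (a + b - 2 * t) * (s - t)| <= 2 * (s - t) ^+ 2.
    have h6 : `|a + b - 2 * t| <= 1 by rewrite ler_norml; apply/andP; split; lra.
    rewrite -(real_normK (num_real (s - t))) 3!normrM (ger0_norm h1) normr_nat.
    have h7 : (t - a) * (b - t) * `|a + b - 2 * t| <= `|s - t|.
      by rewrite (le_trans _ h2)// ler_piMr.
    have := ler_wpM2r (normr_ge0 (s - t)) h7.
    by rewrite expr2; nra.
  move: h5; rewrite ler_norml => /andP[? ?].
  by apply/andP; split; nra.
- by rewrite mul0r !subr0; have := sqr_ge0 (s - t); lra.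
Qed.

Lemma bump_lipschitz a b s t : a <= b <= a + 1 ->
  `|bump a b s - bump a b t| <= `|s - t|.
Proof.
move=> /andP[ab b1]; rewrite /bump.
case: ifPn => [/andP[as_ sb]|sab]; case: ifPn => [/andP[at_ tb]|tab].
- have -> : ((s - a) * (b - s)) ^+ 2 - ((t - a) * (b - t)) ^+ 2 =
      (a + b - s - t) * ((s - a) * (b - s) + (t - a) * (b - t)) * (s - t) by ring.
  have h1 : 0 <= (t - a) * (b - t) by apply: mulr_ge0; lra.
  have h2 : 0 <= (s - a) * (b - s) by apply: mulr_ge0; lra.
  have h3 : (t - a) * (b - t) <= 1 / 2 by nra.
  have h4 : (s - a) * (b - s) <= 1 / 2 by nra.
  rewrite 2!normrM ler_piMl// -[leRHS]mulr1 ler_pM// ler_norml; apply/andP; split; lra.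
- have h1 : 0 <= (s - a) * (b - s) by apply: mulr_ge0; lra.
  have h2 : (s - a) * (b - s) <= 1 by nra.
  rewrite subr0 normrX ger0_norm// expr2 (@le_trans _ _ ((s - a) * (b - s)))//.
    by rewrite ler_piMl.
  have [ta|at_] := ltP t a; first by rewrite ger0_norm; nra.
  have bt : b < t by rewrite ltNge; apply: contra tab => tb; rewrite at_.
  by rewrite ler0_norm; nra.
- have h1 : 0 <= (t - a) * (b - t) by apply: mulr_ge0; lra.
  have h2 : (t - a) * (b - t) <= 1 by nra.
  rewrite sub0r normrN normrX ger0_norm// expr2.
  rewrite (@le_trans _ _ ((t - a) * (b - t)))//; first by rewrite ler_piMl.
  have [sa|as_] := ltP s a; first by rewrite ler0_norm; nra.
  have bs : b < s by rewrite ltNge; apply: contra sab => sb; rewrite as_.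
  by rewrite ger0_norm; nra.
- by rewrite subr0 normr0.
Qed.

Lemma bump_out a b t : ~~ (a < t < b) -> bump a b t = 0.
Proof.
rewrite /bump; case: ifP => [/andP[h1 h2]|//]; rewrite negb_and -!leNgt.
by move=> /orP[h|h]; [have -> : t = a by lra|have -> : t = b by lra];
  rewrite subrr ?(mul0r, mulr0) expr0n.
Qed.

Lemma dbump_out a b t : ~~ (a < t < b) -> dbump a b t = 0.
Proof.
rewrite /dbump; case: ifP => [/andP[h1 h2]|//]; rewrite negb_and -!leNgt.
by move=> /orP[h|h]; [have -> : t = a by lra|have -> : t = b by lra];
  rewrite subrr ?(mul0r, mulr0).
Qed.

End Bump.

(** * Signed bumps on disjoint blocks *)

Section Oscillation.
Variable R : realType.
Implicit Types (s t : R) (k : nat) (sg : nat -> R).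

Definition lo k : R := k.+2%:R^-1.
Definition hi k : R := k.+1%:R^-1.
(* The value is junk outside [`]0, 1[], where all bumps vanish. *)
Definition block t : nat := (Num.truncn t^-1).-1.

(** This is the sum over all [k] of [sg k] times the [k]-th bump: block interiors are disjoint, so
    only the term of index [block t] can be nonzero. *)
Definition osc sg t : R := sg (block t) * bump (lo (block t)) (hi (block t)) t.
Definition dosc sg t : R := sg (block t) * dbump (lo (block t)) (hi (block t)) t.

Lemma lo_hi k : lo k < hi k <= lo k + 1.
Proof.
have h : hi k <= 1 by rewrite invf_le1 ?ltr0n// ler1n.
have h0 : 0 < lo k by rewrite invr_gt0 ltr0n.
by rewrite ltf_pV2 ?posrE ?ltr0n// ltr_nat ltnSn/=; lra.
Qed.

Let lohi k : lo k <= hi k <= lo k + 1.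
Proof. by have /andP[/ltW -> ->] := lo_hi k. Qed.

(** Here [t^-1] lies between [k + 1] and [k + 2], so its truncation is [k + 1]. *)
Lemma block_in k t : lo k < t < hi k -> block t = k.
Proof.
move=> /andP[h1 h2]; rewrite /block (@truncn_def _ _ k.+1)//.
have t0 : 0 < t by rewrite (lt_trans _ h1)// invr_gt0 ltr0n.
rewrite -[X in X <= _]invrK -[X in _ < X]invrK.
by rewrite lef_pV2 ?ltf_pV2 ?posrE ?invr_gt0 ?ltr0n// h1 ltW.
Qed.

Lemma block_out k t : k != block t -> ~~ (lo k < t < hi k).
Proof. by apply: contraNN => /block_in ->. Qed.

Lemma osc_taylor sg s t : (forall k, `|sg k| <= 1) ->
  `|osc sg s - osc sg t - dosc sg t * (s - t)| <= 6 * (s - t) ^+ 2.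
Proof.
move=> sg1; rewrite /osc /dosc; set j := block t; set k := block s.
pose T i := bump (lo i) (hi i) s - bump (lo i) (hi i) t - dbump (lo i) (hi i) t * (s - t).
have T3 i : `|sg i * T i| <= 3 * (s - t) ^+ 2.
  by rewrite normrM (le_trans _ (bump_taylor s t (lohi i)))// ler_piMl.
have [jk|jk] := eqVneq j k.
  rewrite -jk (_ : _ - _ = sg j * T j); last by rewrite /T; ring.
  by rewrite (le_trans (T3 j))// ler_wpM2r ?sqr_ge0// ler_nat.
(* For points in different blocks, each bump vanishes at the other point, so two one-bump remainders
   add up; hence 6 = 3 + 3. *)
rewrite (_ : _ - _ = sg k * T k + sg j * T j).
  by have := T3 k; have := T3 j; have := ler_normD (sg k * T k) (sg j * T j); lra.
rewrite /T (bump_out (block_out jk)).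
have kj : k != j by rewrite eq_sym.
rewrite (bump_out (block_out kj)) (dbump_out (block_out kj)).
by ring.
Qed.

Lemma osc_lipschitz sg s t : (forall k, `|sg k| <= 1) ->
  `|osc sg s - osc sg t| <= 2 * `|s - t|.
Proof.
move=> sg1; rewrite /osc; set j := block t; set k := block s.
pose T i := bump (lo i) (hi i) s - bump (lo i) (hi i) t.
have T3 i : `|sg i * T i| <= `|s - t|.
  by rewrite normrM (le_trans _ (bump_lipschitz s t (lohi i)))// ler_piMl.
have [jk|jk] := eqVneq j k.
  rewrite -jk (_ : _ - _ = sg j * T j); last by rewrite /T; ring.
  by have := T3 j; have := normr_ge0 (s - t); lra.
rewrite (_ : _ - _ = sg k * T k + sg j * T j).
  by have := T3 k; have := T3 j; have := ler_normD (sg k * T k) (sg j * T j); lra.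
rewrite /T (bump_out (block_out jk)).
have kj : k != j by rewrite eq_sym.
by rewrite (bump_out (block_out kj)); ring.
Qed.

(** Adding the Taylor estimates at [s] and at [t] cancels the function values; dividing by [|s - t|]
    leaves the constant 12 = 6 + 6. *)
Lemma dosc_lipschitz sg s t : (forall k, `|sg k| <= 1) ->
  `|dosc sg s - dosc sg t| <= 12 * `|s - t|.
Proof.
move=> sg1; have := osc_taylor s t sg1; have := osc_taylor t s sg1.
rewrite !ler_norml => /andP[h1 h2] /andP[h3 h4].
have [->|st] := eqVneq s t; first by rewrite !subrr !normr0; lra.
have : `|(dosc sg s - dosc sg t) * (s - t)| <= 12 * `|s - t| * `|s - t|.
  have -> : 12 * `|s - t| * `|s - t| = 12 * (s - t) ^+ 2.
    by rewrite -mulrA -expr2 real_normK ?num_real.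
  by rewrite ler_norml; apply/andP; split; nra.
by rewrite normrM ler_pM2r ?normr_gt0 ?subr_eq0// ler_norml.
Qed.

Definition mid k : R := (lo k + hi k) / 2.

(** On the middle half of a block both endpoint distances are at least a quarter of its length, and
    the bump is the square of their product. *)
Lemma osc_mid sg k t : `|t - mid k| <= (hi k - lo k) / 4 ->
  exists2 h, osc sg t = sg k * h & (hi k - lo k) ^+ 4 / 256 <= h.
Proof.
rewrite ler_norml /mid => /andP[h1 h2]; have /andP[h3 h4] := lo_hi k.
rewrite /osc (@block_in k); last by apply/andP; split; lra.
eexists; first by [].
rewrite /bump ifT; last by apply/andP; split; lra.
have -> : (hi k - lo k) ^+ 4 / 256 = (((hi k - lo k) / 4) * ((hi k - lo k) / 4)) ^+ 2 :> R.
  by field.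
rewrite lerXn2r ?nnegrE ?mulr_ge0//; try lra.
by apply: ler_pM; lra.
Qed.

End Oscillation.

(** * Euclidean norm, and gradients from quadratic remainders *)

Section Enorm.
Variables (R : realType).

Lemma enorm_ge0 n (x : 'rV[R]_n) : 0 <= enorm x.
Proof. exact: sqrtr_ge0. Qed.

Lemma sqr_enorm n (x : 'rV[R]_n) : enorm x ^+ 2 = \sum_j x 0 j ^+ 2.
Proof. by rewrite /enorm sqr_sqrtr// sumr_ge0// => j _; rewrite sqr_ge0. Qed.

Lemma coord_le_enorm n (x : 'rV[R]_n) j : `|x 0 j| <= enorm x.
Proof.
rewrite -(@ler_pXn2r _ 2)// ?nnegrE ?enorm_ge0// sqr_enorm real_normK ?num_real//.
by rewrite (bigD1 j)//= lerDl sumr_ge0// => i _; rewrite sqr_ge0.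
Qed.

Lemma norm_le_enorm n (x : 'rV[R]_n) : `|x| <= enorm x.
Proof.
rewrite [leLHS]/Num.Def.normr/= mx_normrE; apply/bigmax_leP.
by split=> [|[i j] _] /=; [exact: enorm_ge0|rewrite ord1 coord_le_enorm].
Qed.

Lemma coord_le_norm n (x : 'rV[R]_n) j : `|x 0 j| <= `|x|.
Proof.
rewrite [leRHS]/Num.Def.normr/= mx_normrE.
exact: (le_bigmax _ (fun ij => `|x ij.1 ij.2|) (0, j)).
Qed.

Lemma enorm_le_norm n (x : 'rV[R]_n) : enorm x <= n%:R * `|x|.
Proof.
rewrite -(@ler_pXn2r _ 2)// ?nnegrE ?enorm_ge0 ?mulr_ge0// sqr_enorm.
apply: (@le_trans _ _ (\sum_(j < n) `|x| ^+ 2)).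
  apply: ler_sum => j _; rewrite -[leLHS]ger0_norm ?sqr_ge0// normrX.
  by rewrite lerXn2r ?nnegrE// coord_le_norm.
rewrite sumr_const card_ord exprMn -[leLHS]mulr_natl ler_wpM2r ?sqr_ge0//.
by rewrite -natrX ler_nat; case: n {x} => // n; rewrite expnS expn1 leq_pmulr.
Qed.

(** The topology is that of the sup norm, so the estimate is transferred through the two norm
    comparisons above. *)
Lemma enorm_lipschitz_continuous n m (h : 'rV[R]_n -> 'rV[R]_m) (L : R) :
  (forall x y, enorm (h x - h y) <= L * enorm (x - y)) -> continuous h.
Proof.
move=> hL x; apply/(@cvgrPdist_le _ _ _ (nbhs x) (nbhs_filter x)) => e e0.
(* The added 1 allows division even when [L] or [n] is zero. *)
have C0 : 0 < `|L| * n%:R + 1 by rewrite ltr_wpDl// mulr_ge0.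
near=> y.
rewrite (le_trans (norm_le_enorm _))// (le_trans (hL _ _))//.
rewrite (@le_trans _ _ (`|L| * n%:R * `|x - y|))//.
  rewrite (@le_trans _ _ (`|L| * enorm (x - y)))//.
    by rewrite ler_wpM2r ?enorm_ge0// ler_norm.
  by rewrite -mulrA ler_wpM2l// enorm_le_norm.
rewrite (@le_trans _ _ ((`|L| * n%:R + 1) * `|x - y|))//.
  by rewrite ler_wpM2r// lerDl.
rewrite -ler_pdivlMl// mulrC.
near: y; apply: cvgr_dist_le; [exact: cvg_id|by rewrite divr_gt0].
Unshelve. all: by end_near. Qed.

Section Taylor.
Variable n : nat.
Implicit Types (h : 'rV[R]_n -> R) (x G v : 'rV[R]_n).

Definition dotr G v : R := \sum_(j < n) G 0 j * v 0 j.

Fact dotr_is_linear G : linear (dotr G : 'rV[R]_n -> R^o).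
Proof.
move=> a u v; rewrite /dotr scaler_sumr -big_split/=; apply: eq_bigr => j _.
by rewrite !mxE mulrDr [a *: _]mulrCA.
Qed.
HB.instance Definition _ G := GRing.isLinear.Build R 'rV[R]_n R^o _ (dotr G)
  (dotr_is_linear G).

Lemma dotr_continuous G : continuous (dotr G).
Proof.
apply: continuous_big => [|j _ x]; first exact: add_continuous.
by apply: continuousM; [exact: cst_continuous|exact: coord_continuous].
Qed.

(** A quadratic remainder is little-o of the increment, so by uniqueness the differential is
    [dotr G]; its values on the basis vectors are the entries of [G]. *)
Lemma taylor_gradient h x G C :
  (\forall y \near x, `|h y - h x - dotr G (y - x)| <= C * enorm (y - x) ^+ 2) ->
  differentiable h x /\ gradient h x = G.
Proof.
move=> hC.
have hE : (h : _ -> R^o) \o shift x =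
    cst (h x) + (dotr G : _ -> R^o) +o_ (0 : 'rV[R]_n) id.
  apply/eqaddoP => _/posnumP[e].
  have C0 : 0 < `|C| * n%:R ^+ 2 + 1 by rewrite ltr_wpDl// mulr_ge0.
  have hx : (shift x) v @[v --> (0 : 'rV[R]_n)] --> x.
    rewrite -[X in _ --> X](add0r x).
    exact: (@cvgD _ _ _ (nbhs (0 : 'rV[R]_n)) _ id (cst x) 0 x cvg_id (cvg_cst _)).
  have small : \forall v \near (0 : 'rV[R]_n), `|v| <= e%:num / (`|C| * n%:R ^+ 2 + 1).
    apply: (@cvgr0_norm_le _ _ _ (nbhs (0 : 'rV[R]_n)) _ id); first exact: cvg_id.
    by rewrite divr_gt0.
  move: (hx _ hC); near_simpl => {hC}; apply: filterS2 small => v small hv.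
  rewrite -![(_ + _ : _ -> _) _]/(_ + _) -![(- _ : _ -> _) _]/(- _) /=.
  rewrite opprD addrA -[v in dotr G v](addrK x).
  apply: (@le_trans _ _ (C * enorm (v + x - x) ^+ 2)) => //.
  rewrite addrK (@le_trans _ _ (`|C| * (n%:R * `|v|) ^+ 2))//.
    rewrite (@le_trans _ _ (`|C| * enorm v ^+ 2))//.
      by rewrite ler_wpM2r ?sqr_ge0// ler_norm.
    by rewrite ler_wpM2l// lerXn2r ?nnegrE ?enorm_ge0 ?mulr_ge0 ?enorm_le_norm.
  rewrite exprMn mulrA [X in _ * X]expr2 mulrA ler_wpM2r//.
  rewrite (@le_trans _ _ ((`|C| * n%:R ^+ 2 + 1) * `|v|))//.
    by rewrite ler_wpM2r// lerDl.
  by rewrite -ler_pdivlMl// mulrC.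
have := @diff_unique R _ _ h (dotr G : {linear _ -> R^o}) x (@dotr_continuous G).
move=> /(_ hE) dG.
have dh : differentiable h x.
  by apply/diff_locallyP; rewrite dG; split => //; exact: dotr_continuous.
split=> //; apply/rowP => j; rewrite mxE deriveE// dG /= /dotr.
rewrite (bigD1 j)//= big1 ?addr0; first by rewrite mxE !eqxx mulr1.
by move=> i ij; rewrite mxE eqxx (negbTE ij) mulr0.
Qed.

End Taylor.
End Enorm.

(** * The integrand for a fixed sign pattern: smoothness, convexity, gradient *)

Section Integrand.
Variables (R : realType) (sg : nat -> R).
Hypothesis sg1 : forall k, `|sg k| <= 1.
Implicit Types x y : 'rV[R]_2.

Definition tilt x : R := x 0 0 + osc sg (x 0 1).
Definition dtilt x : 'rV[R]_2 := \row_j (if j == 0 then 1 else dosc sg (x 0 1)).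
Definition ridge x : R := Num.max (tilt x) 0 + 35 * enorm x ^+ 2.

Lemma sum_ord2 (F : 'I_2 -> R) : \sum_j F j = F 0 + F 1.
Proof.
by rewrite !big_ord_recl big_ord0 addr0; congr (_ + F _); exact: val_inj.
Qed.

Lemma sqr_enorm2 x : enorm x ^+ 2 = x 0 0 ^+ 2 + x 0 1 ^+ 2.
Proof. by rewrite sqr_enorm sum_ord2. Qed.

Lemma dotr_dtilt x y : dotr (dtilt x) y = y 0 0 + dosc sg (x 0 1) * y 0 1.
Proof. by rewrite /dotr sum_ord2 !mxE/= mul1r. Qed.

Lemma tilt_taylor x y :
  `|tilt y - tilt x - dotr (dtilt x) (y - x)| <= 6 * enorm (y - x) ^+ 2.
Proof.
rewrite dotr_dtilt /tilt !mxE.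
have := osc_taylor (y 0 1) (x 0 1) sg1; set d := dosc _ _ => h.
rewrite (_ : _ - _ = osc sg (y 0 1) - osc sg (x 0 1) - d * (y 0 1 - x 0 1)); last by ring.
by rewrite (le_trans h)// ler_wpM2l// sqr_enorm2 !mxE lerDr sqr_ge0.
Qed.

Lemma tilt_lipschitz x y : `|tilt x - tilt y| <= 3 * enorm (x - y).
Proof.
have := osc_lipschitz (x 0 1) (y 0 1) sg1.
have := coord_le_enorm (x - y) 0; have := coord_le_enorm (x - y) 1.
rewrite !mxE /tilt => h1 h0 h.
have := ler_normD (x 0 0 - y 0 0) (osc sg (x 0 1) - osc sg (y 0 1)).
by rewrite addrACA -opprD; lra.
Qed.

Lemma dtilt_lipschitz x y : enorm (dtilt x - dtilt y) <= 12 * enorm (x - y).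
Proof.
rewrite -(@ler_pXn2r _ 2)// ?nnegrE ?mulr_ge0 ?enorm_ge0// sqr_enorm2 !mxE/= subrr.
rewrite expr0n add0r -(real_normK (num_real _)).
rewrite lerXn2r ?nnegrE ?mulr_ge0 ?enorm_ge0//.
rewrite (le_trans (dosc_lipschitz _ _ sg1))// ler_wpM2l//.
by have := coord_le_enorm (x - y) 1; rewrite !mxE.
Qed.

Lemma dtilt_continuous : continuous dtilt.
Proof. exact: enorm_lipschitz_continuous dtilt_lipschitz. Qed.

Lemma tilt_gradient x : differentiable tilt x /\ gradient tilt x = dtilt x.
Proof.
by apply: (@taylor_gradient _ _ _ _ _ 6); near=> y; exact: tilt_taylor.
Unshelve. all: by end_near. Qed.

Lemma gradient_tilt : gradient tilt = dtilt.
Proof. by apply/funext => x; have [] := tilt_gradient x. Qed.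

Lemma tilt_continuous : continuous tilt.
Proof. by move=> x; apply: differentiable_continuous; have [] := tilt_gradient x. Qed.

Lemma tilt_smooth : euclidean_smooth 70 tilt.
Proof.
split; rewrite ?gradient_tilt; first by move=> x; have [] := tilt_gradient x.
  exact: dtilt_continuous.
move=> x y; rewrite (le_trans (dtilt_lipschitz x y))//.
by rewrite ler_wpM2r ?enorm_ge0// ler_nat.
Qed.

Lemma ridge_lipschitz : euclidean_lipschitz 140 (@segX R) ridge.
Proof.
move=> x y [x0 /andP[x1 x2]] [y0 /andP[y1 y2]].
have := tilt_lipschitz x y; have := coord_le_enorm (x - y) 1.
rewrite !mxE /ridge !sqr_enorm2 x0 y0; set e := enorm _ => h1 h2.
have h3 : `|Num.max (tilt x) 0 - Num.max (tilt y) 0| <= `|tilt x - tilt y|.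
  have := ler_norm (tilt x - tilt y); have := lerNnormlW (lexx `|tilt x - tilt y|).
  rewrite ler_norml; case: (leP (tilt x) 0); case: (leP (tilt y) 0) => *;
    by apply/andP; split; lra.
(* On the segment both second coordinates lie in [0,1], so their sum is at most 2 and 70 = 35 * 2;
   with the 3 from [tilt] this stays below 140. *)
have h4 : `|35 * (x 0 1 ^+ 2 - y 0 1 ^+ 2)| <= 70 * e.
  rewrite subr_sqr normrM normr_nat normrM.
  have : `|x 0 1 + y 0 1| <= 2 by rewrite ger0_norm; lra.
  by have := normr_ge0 (x 0 1 - y 0 1); nra.
rewrite !expr0n/= !add0r opprD addrACA -mulrBr (le_trans (ler_normD _ _))//.
have := enorm_ge0 (x - y); rewrite -/e; lra.
Qed.

(* The quadratic term dominates the lack of convexity of [tilt], which by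
   [tilt_taylor] is at most that of [- 6 * enorm x ^+ 2]. *)
Lemma ridge_convex : convex_function setT ridge.
Proof.
move=> t x y _ _; rewrite convRE.
have l0 : 0 <= t%:num by exact: ge0.
have l1 : t%:num <= 1 by exact: le1.
set l := t%:num in l0 l1 *.
set m := (conv t _ _); have mE : m = l *: (x : 'rV[R]_2) + (1 - l) *: (y : 'rV[R]_2) by [].
clearbody m l.
have hx := tilt_taylor m x; have hy := tilt_taylor m y.
move: hx hy; rewrite !dotr_dtilt !ler_norml => /andP[hx _] /andP[hy _].
rewrite /ridge; move: hx hy; rewrite !sqr_enorm2 mE !mxE -mE.
set d := dosc _ _; set x0 := x 0 0; set x1 := x 0 1; set y0 := y 0 0; set y1 := y 0 1.
set tx := tilt x; set ty := tilt y; set tm := tilt m.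
have -> : x0 - (l * x0 + (1 - l) * y0) = (1 - l) * (x0 - y0) by ring.
have -> : x1 - (l * x1 + (1 - l) * y1) = (1 - l) * (x1 - y1) by ring.
have -> : y0 - (l * x0 + (1 - l) * y0) = - l * (x0 - y0) by ring.
have -> : y1 - (l * x1 + (1 - l) * y1) = - l * (x1 - y1) by ring.
move=> hx hy.
set S := (x0 - y0) ^+ 2 + (x1 - y1) ^+ 2.
have S0 : 0 <= S by rewrite addr_ge0 ?sqr_ge0.
have ll : 0 <= l * (1 - l) by rewrite mulr_ge0// subr_ge0.
(* Averaging the Taylor bounds at [m] with weights [l] and [1 - l] cancels the first-order terms;
   the quadratic ones combine through [l * (1 - l) ^+ 2 + (1 - l) * l ^+ 2 = l * (1 - l)]. *)
have hm : tm <= l * tx + (1 - l) * ty + 6 * (l * (1 - l)) * S.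
  have l1' : 0 <= 1 - l by rewrite subr_ge0.
  have := lerD (ler_wpM2l l0 hx) (ler_wpM2l l1' hy).
  by rewrite /S; lra.
have hmx : tx <= Num.max tx 0 /\ 0 <= Num.max tx 0 by rewrite !le_max !lexx orbT.
have hmy : ty <= Num.max ty 0 /\ 0 <= Num.max ty 0 by rewrite !le_max !lexx orbT.
have hmm : Num.max tm 0 <= l * Num.max tx 0 + (1 - l) * Num.max ty 0 + 6 * (l * (1 - l)) * S.
  case: hmx => a1 a2; case: hmy => b1 b2.
  have l1' : 0 <= 1 - l by rewrite subr_ge0.
  have := ler_wpM2l l0 a1; have := ler_wpM2l l1' b1.
  have := mulr_ge0 l0 a2; have := mulr_ge0 l1' b2.
  have := mulr_ge0 ll S0.
  by rewrite ge_max => *; apply/andP; split; lra.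
have := mulr_ge0 ll S0; rewrite /unstable.onem.
by move: hmm; rewrite /S; lra.
Qed.

Lemma sqr_enorm_taylor n (x y : 'rV[R]_n) :
  enorm y ^+ 2 - enorm x ^+ 2 - dotr (2 *: x) (y - x) = enorm (y - x) ^+ 2.
Proof.
rewrite !sqr_enorm /dotr -!sumrB; apply: eq_bigr => j _.
by rewrite !mxE; ring.
Qed.

Lemma dotrDl n (a b c : 'rV[R]_n) : dotr (a + b) c = dotr a c + dotr b c.
Proof. by rewrite /dotr -big_split/=; apply: eq_bigr => j _; rewrite mxE mulrDl. Qed.

Lemma dotrZl n k (a c : 'rV[R]_n) : dotr (k *: a) c = k * dotr a c.
Proof. by rewrite /dotr mulr_sumr; apply: eq_bigr => j _; rewrite mxE mulrA. Qed.

(** By continuity [tilt] stays positive near [x], so locally the maximum is [tilt] itself; the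
    remainder constant is 41 = 6 + 35. *)
Lemma ridge_gradient_pos x : 0 < tilt x ->
  differentiable ridge x /\ gradient ridge x = dtilt x + 70 *: x.
Proof.
move=> x0; apply: (@taylor_gradient _ _ _ _ _ 41).
have hx : \forall y \near x, 0 < tilt y.
  by apply: (@cvgr_gt _ _ (nbhs x) _ tilt) x0; exact: tilt_continuous.
apply: filterS hx => y y0.
rewrite /ridge (max_l (ltW x0)) (max_l (ltW y0)) dotrDl.
have -> : 70 *: x = 35 *: (2 *: x) by rewrite scalerA; congr (_ *: _); ring.
rewrite dotrZl.
rewrite (_ : _ - _ = (tilt y - tilt x - dotr (dtilt x) (y - x)) +
  35 * (enorm y ^+ 2 - enorm x ^+ 2 - dotr (2 *: x) (y - x))); last by ring.
rewrite sqr_enorm_taylor (le_trans (ler_normD _ _))//.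
rewrite [X in _ + X]ger0_norm ?mulr_ge0 ?enorm_ge0//.
by have := tilt_taylor x y; have := sqr_ge0 (enorm (y - x)); lra.
Qed.

Lemma ridge_gradient_neg x : tilt x < 0 ->
  differentiable ridge x /\ gradient ridge x = 70 *: x.
Proof.
move=> x0; apply: (@taylor_gradient _ _ _ _ _ 35).
have hx : \forall y \near x, tilt y < 0.
  by apply: (@cvgr_lt _ _ (nbhs x) _ tilt) x0; exact: tilt_continuous.
apply: filterS hx => y y0.
rewrite /ridge (max_r (ltW x0)) (max_r (ltW y0)) !add0r.
have -> : 70 *: x = 35 *: (2 *: x) by rewrite scalerA; congr (_ *: _); ring.
by rewrite dotrZl -mulrBr -mulrBr sqr_enorm_taylor ger0_norm ?mulr_ge0 ?enorm_ge0.
Qed.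

Definition node k : 'rV[R]_2 := \row_j (if j == 0 then 0 else mid R k).

(** * Behaviour on a small ball around a block midpoint *)

Section Ball.
Variables (k : nat) (b : bool) (r : R).
Hypothesis rk : r <= (hi R k - lo R k) ^+ 4 / 1000.
Hypothesis sgk : sg k = if b then 1 else -1.

(** In the ball [y 0 1] stays in the middle half of block [k], where the bump is at least
    [l ^+ 4 / 256] for [l] the block length. As [|y 0 0|] is at most [l ^+ 4 / 1000], [sg k] decides
    the sign. *)
Let tilt_ball y : eball (node k) r y -> if b then 0 < tilt y else tilt y < 0.
Proof.
move=> yr; have /andP[lh hl] := lo_hi R k.
have := le_trans (coord_le_enorm (y - node k) 0) yr.
have := le_trans (coord_le_enorm (y - node k) 1) yr.
rewrite !mxE/= subr0 => y1 y0.
have l0 : 0 < hi R k - lo R k by rewrite subr_gt0.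
have l4 : (hi R k - lo R k) ^+ 4 <= hi R k - lo R k.
  by rewrite exprS ler_piMr ?(ltW l0)// exprn_ile1 ?(ltW l0)//; lra.
have l40 : 0 < (hi R k - lo R k) ^+ 4 by rewrite exprn_gt0.
have := rk; set e := hi R k - lo R k in l0 l4 l40 * => rke.
have [|h hE] := @osc_mid R sg k (y 0 1); rewrite -/e.
  by rewrite (le_trans y1)// (le_trans rke)//; lra.
set q := e ^+ 4 in rke l4 l40 * => hl'.
rewrite /tilt hE sgk; move: y0; rewrite ler_norml => /andP[a1 a2].
by case: (b); lra.
Qed.

Lemma ridge_ball y : eball (node k) r y ->
  differentiable ridge y /\
  gradient ridge y = (if b then dtilt y else 0) + 70 *: y.
Proof.
move/tilt_ball; case: (b) => [/ridge_gradient_pos//|/ridge_gradient_neg].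
by rewrite add0r.
Qed.

Lemma ridge_C1 : C1_on (eball (node k) r) ridge.
Proof.
split=> [y /ridge_ball[]//|].
pose G y : 'rV[R]_2 := (if b then dtilt y else 0) + 70 *: y.
(* On the ball the gradient coincides with [G], which is continuous on the whole plane. *)
apply: (@subspace_eq_continuous _ _ _ G).
  by move=> y; rewrite inE => /ridge_ball[].
apply: continuous_subspaceT => y; apply: continuousD; last first.
  by apply: continuousZl_tmp; exact: cvg_id.
have := dtilt_continuous (x := y).
by case: (b) => [//|_]; exact: (@cvg_cst _ (0 : 'rV[R]_2) _ (nbhs y)).
Qed.

End Ball.
End Integrand.

(** * Finite unions of short intervals and their probability *)

Section Cells.
Variable R : realType.
Local Notation mu := (@lebesgue_measure R).

Definition cell (n j : nat) : set R := `[j%:R / n%:R, j.+1%:R / n%:R]%classic.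

(** The mesh is tied to the length of the list, so the total length is at most 1/4 whatever the
    list. *)
Definition cells (s : seq nat) : set R :=
  \big[setU/set0]_(j <- s) cell (4 * size s) j.

Lemma measurable_cells s : measurable (cells s).
Proof. by apply: bigsetU_measurable => j _; exact: measurable_itv. Qed.

Lemma mem_cells s j z : j \in s -> cell (4 * size s) j z -> cells s z.
Proof. by move=> js jz; rewrite /cells -bigcup_seq; exists j. Qed.

Lemma cell_truncn n z : (0 < n)%N -> 0 <= z -> cell n (Num.truncn (n%:R * z)) z.
Proof.
move=> n0 z0; rewrite /cell/= in_itv/=.
have n0' : (0 : R) < n%:R by rewrite ltr0n.
have /andP[h1 h2] : _ := truncn_itv (mulr_ge0 (ltW n0') z0).
by rewrite ler_pdivrMr// ler_pdivlMr// ![z * _]mulrC h1 ltW.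
Qed.

(** The uniform density is at most 1. *)
Lemma uniform_prob_le A : measurable A -> (uniform_prob (@ltr01 R) A <= mu A)%E.
Proof.
move=> mA; rewrite /uniform_prob -[leRHS]mul1e -integral_cst//.
apply: ge0_le_integral => //=.
- by move=> x _; rewrite lee_fin uniform_pdf_ge0.
- by apply/measurable_EFinP/measurable_funTS; exact: measurable_uniform_pdf.
- move=> x _; rewrite lee_fin /uniform_pdf; case: ifPn => //.
  by rewrite subr0 invr1.
Qed.

Lemma uniform_prob_cells s : (uniform_prob (@ltr01 R) (cells s) <= (1 / 4)%:E)%E.
Proof.
rewrite (le_trans (uniform_prob_le (measurable_cells s)))// /cells.
(* The mesh is decoupled from the list, since in [cells] it would change along the induction. *)
have bound n (r : seq nat) :
    (mu (\big[setU/set0]_(j <- r) cell n.+1 j) <= ((size r)%:R / n.+1%:R)%:E)%E.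
  elim: r => [|j r ih]; first by rewrite big_nil measure0 lee_fin mul0r.
  have mc i : measurable (cell n.+1 i) by exact: measurable_itv.
  rewrite big_cons (le_trans (measureU2 mu (mc j) (bigsetU_measurable _ (fun i _ => mc i))))//.
  rewrite /= -nat1r mulrDl EFinD leeD// /cell lebesgue_measure_itv/= lte_fin.
  rewrite ltr_pM2r ?invr_gt0 ?ltr0n// ltr_nat ltnSn -EFinB lee_fin -mulrBl.
  by rewrite -natr1 [X in X - _]addrC addrK.
(* The empty list is separate because its mesh [4 * size s] is zero. *)
case: s => [|j s]; first by rewrite big_nil measure0 lee_fin.
have := bound (4 * size (j :: s)).-1 (j :: s); rewrite prednK ?muln_gt0//.
move=> /le_trans; apply; rewrite lee_fin natrM.
by rewrite invfM mulrCA mulfV ?mulr1 ?mul1r// pnatr_eq0.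
Qed.

End Cells.

(** * Expectation of a two-valued variable *)

Section Expectation.
Context d (T : measurableType d) (R : realType) (P : probability T R).

Lemma expectation_two_values (B : set T) (u v : R) : measurable B ->
  ('E_P[fun w => if w \in B then u else v])%E =
    ((u - v) * fine (P B) + v)%:E.
Proof.
move=> mB.
have -> : (fun w => if w \in B then u else v) = ((u - v) \o* \1_B) \+ cst v.
  apply/funext => w /=; rewrite indicE; case: (w \in B) => /=.
    by rewrite mul1r subrK.
  by rewrite mul0r add0r.
have L1 : (\1_B : T -> R) \in Lfun P 1.
  by apply/Lfun1_integrable; apply: integrable_indic => //; rewrite ltey_eq fin_num_measure.
have L2 : (cst v : T -> R) \in Lfun P 1 by exact: Lfun_cst.
have L3 : ((u - v) \o* \1_B : T -> R) \in Lfun P 1 by exact: Lfun_scale.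
rewrite expectationD// expectationZl// expectation_cst expectation_indic//.
by rewrite [RHS]EFinD [in RHS]EFinM fineK// fin_num_measure.
Qed.

End Expectation.

(** * The radii and their dependence on the sample size *)

Section Radius.
Variable R : realType.

(* [level n] bounds the codes of the sequences of cells that samples of size [n]
   can meet. *)
Definition level n : nat :=
  \max_(t : n.-tuple 'I_(4 * n).+1) CodeSeq.code [seq nat_of_ord i | i <- t].

(** Summing the levels up to [n] makes this monotone, and the extra [n] forces the radius to tend to
    0. *)
Definition depth n : nat := (n + \sum_(m < n.+1) level m)%N.

(** Block [k] has length [1 / ((k + 1) * (k + 2))], at least [(k + 2) ^- 2]; its fourth power
    explains the exponent 8, uniformly over [k <= depth n]. *)
Definition radius n : R := (1000 * (depth n).+2%:R ^+ 8)^-1.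

Lemma depth_mono m n : (m <= n)%N -> (depth m <= depth n)%N.
Proof.
move=> mn; rewrite leq_add//.
rewrite (big_ord_widen n.+1 level)// big_mkcond leq_sum// => i _.
by case: ifP.
Qed.

Lemma code_le_depth n (t : n.-tuple 'I_(4 * n).+1) :
  (CodeSeq.code [seq nat_of_ord i | i <- t] <= depth n)%N.
Proof.
rewrite (@leq_trans (level n))//.
  exact: (leq_bigmax (F := fun t : n.-tuple _ => CodeSeq.code [seq nat_of_ord i | i <- t])).
by rewrite /depth big_ord_recr/= addnA leq_addl.
Qed.

Let pow_ge1 n : 1 <= (depth n).+2%:R ^+ 8 :> R.
Proof. by rewrite exprn_ege1// ler1n. Qed.

Let scale_gt0 n : 0 < 1000 * (depth n).+2%:R ^+ 8 :> R.
Proof. by have := pow_ge1 n; lra. Qed.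

Lemma radius_gt0 n : 0 < radius n.
Proof. by rewrite invr_gt0. Qed.

Lemma radius_le n : radius n <= 1 / 1000.
Proof.
have h : ((depth n).+2%:R ^+ 8)^-1 <= 1 :> R by rewrite invf_le1 ?exprn_gt0.
rewrite /radius invfM; move: h.
by move: (((depth n).+2%:R ^+ 8 : R)^-1) => q; lra.
Qed.

Lemma radius_mono n : radius n.+1 <= radius n.
Proof.
have : (depth n).+2%:R ^+ 8 <= (depth n.+1).+2%:R ^+ 8 :> R.
  by rewrite lerXn2r ?nnegrE// ler_nat !ltnS depth_mono.
move=> h; rewrite lef_pV2 ?posrE; [lra|exact: scale_gt0|exact: scale_gt0].
Qed.

Lemma radius_cvg0 : radius @ \oo --> (0 : R).
Proof.
apply: (@squeeze_cvgr _ _ _ _ (fun=> 0) (@harmonic R)).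
- near=> n; apply/andP; split; first exact: ltW (radius_gt0 n).
  have h1 : n.+1%:R <= (depth n).+2%:R :> R.
    by rewrite ler_nat ltnS (@leq_trans (depth n))// leq_addr.
  have h2 : (depth n).+2%:R <= (depth n).+2%:R ^+ 8 :> R.
    by rewrite ler_eXnr// ler1n.
  have := pow_ge1 n => h3.
  rewrite /radius/= lef_pV2 ?posrE; [lra|exact: scale_gt0|exact: ltr0Sn].
- exact: cvg_cst.
- exact: cvg_harmonic.
Unshelve. all: by end_near. Qed.

Lemma radius_block n k : (k <= depth n)%N ->
  radius n <= (hi R k - lo R k) ^+ 4 / 1000.
Proof.
move=> kn; have : ((depth n).+2%:R ^+ 8)^-1 <= (hi R k - lo R k) ^+ 4.
  have -> : hi R k - lo R k = (k.+1%:R * k.+2%:R)^-1.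
    have h1 : k%:R + 1 != 0 :> R by rewrite natr1 pnatr_eq0.
    have h2 : k%:R + 1 + 1 != 0 :> R by rewrite !natr1 pnatr_eq0.
    by rewrite /hi /lo -[k.+2%:R]natr1 -[k.+1%:R]natr1; field; rewrite h1 h2.
  rewrite exprVn lef_pV2 ?posrE ?exprn_gt0 ?mulr_gt0 ?ltr0n//.
  rewrite (exprM _ 2 4) lerXn2r ?nnegrE ?mulr_ge0 ?exprn_ge0//.
  by rewrite expr2 ler_pM// ler_nat !ltnS// (leq_trans kn).
move: ((hi R k - lo R k) ^+ 4) => l h; rewrite /radius invfM; move: h.
by move: (((depth n).+2%:R ^+ 8 : R)^-1) => q; lra.
Qed.

End Radius.

(** * Signs as functions of the random parameter *)

Section Sign.
Variable R : realType.

(** Decoding enumerates all finite sequences of naturals, so every union of cells is attached to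
    some block. *)
Definition sign_of (z : R) (k : nat) : R :=
  if z \in cells (CodeSeq.decode k) then 1 else -1.

Lemma sign_of_le1 z k : `|sign_of z k| <= 1.
Proof. by rewrite /sign_of; case: ifP => _; rewrite ?normrN normr1. Qed.

(** A fixed [x] meets a single block, so the dependence on [z] is affine in one indicator. *)
Lemma measurable_tilt_sign (D : set R) (x : 'rV[R]_2) :
  measurable_fun D (fun z => tilt (sign_of z) x).
Proof.
apply: measurable_funTS; rewrite /tilt /osc.
apply: measurable_funD => //; apply: measurable_funM => //.
rewrite /sign_of; set A := cells _; have mA : measurable A by exact: measurable_cells.
rewrite (_ : (fun z => _) = fun z => \1_A z *+ 2 - 1).
  by apply: measurable_funB => //; apply: measurable_funD; exact: measurable_indic.
by apply/funext => z; rewrite indicE; case: (z \in A); rewrite ?mul0rn ?sub0r// mulr2n addrK.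
Qed.

End Sign.

(** * Expected values and expected gradients *)

Section Sample.
Context d (Omega : measurableType d) (R : realType) (P : probability Omega R).
Variable X : {RV P >-> R}.
Hypothesis X_unif : forall A : set R, measurable A ->
  distribution P X A = uniform_prob (@ltr01 R) A.

Let measurable_hit k : measurable (X @^-1` cells (CodeSeq.decode k)).
Proof.
rewrite -[X @^-1` _]setTI; apply: (measurable_funPT X) => //.
exact: measurable_cells.
Qed.

Let mem_hit (A : set R) w : (w \in X @^-1` A) = (X w \in A).
Proof. by apply/idP/idP; rewrite !inE. Qed.

Let hit_le k : fine (P (X @^-1` cells (CodeSeq.decode k))) <= 1 / 4.
Proof.
rewrite -lee_fin fineK ?fin_num_measure//.
have := X_unif (measurable_cells (R := R) (CodeSeq.decode k)).
by rewrite /distribution/= /pushforward => ->; exact: uniform_prob_cells.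
Qed.

Lemma expectation_ridge_lty x :
  (`| 'E_P[fun w => ridge (sign_of (X w)) x] | < +oo)%E.
Proof.
set k := block (x 0 1).
rewrite (_ : (fun w => _) = fun w => if w \in X @^-1` cells (CodeSeq.decode k)
  then ridge (fun=> 1) x else ridge (fun=> -1) x); last first.
  by apply/funext => w; rewrite /ridge /tilt /osc /sign_of -/k mem_hit; case: ifP.
by rewrite expectation_two_values// abse_EFin ltry.
Qed.

(** The first partial derivative is [1 + 70 * y 0 0] when [X] hits the [k]-th set and [70 * y 0 0]
    otherwise, so its mean exceeds the latter by the hitting probability. *)
Lemma mean_gradient_ridge k r y : r <= (hi R k - lo R k) ^+ 4 / 1000 ->
  eball (node R k) r y ->
  mean_row P (fun w => gradient (ridge (sign_of (X w))) y) 0 0 <= 1 / 4 + 70 * y 0 0.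
Proof.
move=> rk yr; rewrite mxE.
rewrite (_ : (fun w => _) = fun w => if w \in X @^-1` cells (CodeSeq.decode k)
  then 1 + 70 * y 0 0 else 70 * y 0 0); last first.
  apply/funext => w; rewrite mem_hit.
  have [|_ ->] := @ridge_ball R (sign_of (X w)) (sign_of_le1 _) k
    (X w \in cells (CodeSeq.decode k)) r rk _ y yr; first by [].
  by case: ifP => _; rewrite !mxE// add0r.
rewrite expectation_two_values//= addrK mul1r lerD2r.
exact: hit_le.
Qed.

End Sample.

(** * The block adapted to a given sample *)

Section SampleCode.
Variables (R : realType) (n : nat) (z : nat -> R).
Hypothesis z01 : forall i, 0 <= z i <= 1.

(** Entry [i] is the index of a cell containing [z i.+1], as samples are numbered from 1. The value
    1 has index [4 * n], whence the ordinal bound [(4 * n).+1]. *)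
Definition sample_code : nat := CodeSeq.code
  [seq nat_of_ord j | j <-
    [tuple (inord (Num.truncn ((4 * n)%:R * z i.+1)) : 'I_(4 * n).+1) | i < n]].

Lemma sample_code_depth : (sample_code <= depth n)%N.
Proof. exact: code_le_depth. Qed.

Lemma sample_code_hit i : (0 < i <= n)%N ->
  z i \in cells (CodeSeq.decode sample_code).
Proof.
case: i => // i /= ltin; rewrite /sample_code CodeSeq.codeK inE.
have /andP[z0 z1] := z01 i.+1.
have n0 : (0 < 4 * n)%N by rewrite muln_gt0/= (leq_ltn_trans _ ltin).
apply: (@mem_cells _ _ (Num.truncn ((4 * n)%:R * z i.+1))).
  apply/mapP; exists (inord (Num.truncn ((4 * n)%:R * z i.+1))).
    by apply/tnthP; exists (Ordinal ltin); rewrite tnth_mktuple.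
  rewrite inordK// ltnS -(ler_nat R).
  rewrite (@le_trans _ _ ((4 * n)%:R * z i.+1))//.
    by rewrite truncn_le mulr_ge0.
  by rewrite ler_piMr.
by rewrite size_map size_tuple; exact: cell_truncn.
Qed.

End SampleCode.

(** * Empirical gradients near the midpoints *)

Section Node.
Variable R : realType.

Lemma segX_node k : segX (node R k).
Proof.
have /andP[h1 h2] := lo_hi R k.
have h3 : 0 < lo R k by rewrite invr_gt0 ltr0n.
have h4 : hi R k <= 1 by rewrite invf_le1 ?ltr0n// ler1n.
by rewrite /segX/= !mxE/= /mid; split => //; apply/andP; split; lra.
Qed.

Lemma sample_gradient_ridge n (z : nat -> R) k r y : (0 < n)%N ->
  r <= (hi R k - lo R k) ^+ 4 / 1000 -> eball (node R k) r y ->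
  (forall i, (0 < i <= n)%N -> z i \in cells (CodeSeq.decode k)) ->
  (n%:R^-1 *: \sum_(1 <= i < n.+1) gradient (ridge (sign_of (z i))) y) 0 0 =
  1 + 70 * y 0 0.
Proof.
move=> n0 rk yr zk; rewrite mxE summxE big_nat.
rewrite (eq_bigr (fun=> 1 + 70 * y 0 0)); last first.
  move=> i ni; have := zk i ni => zki.
  have [|_ ->] := @ridge_ball R (sign_of (z i)) (sign_of_le1 _) k true r rk _ y yr.
    by rewrite /sign_of zki.
  by rewrite !mxE.
rewrite -big_nat sumr_const_nat subSS subn0 -[X in _ * X]mulr_natl mulKf//.
by rewrite pnatr_eq0 -lt0n.
Qed.

End Node.

(* [xi 0] is the generic variable, [xi 1], [xi 2], ... form the sample. *)
Theorem theorem3 (R : realType) (d : measure_display)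
    (Omega : measurableType d) (P : probability Omega R)
    (Pcomplete : measure_is_complete P)
    (xi : nat -> {RV P >-> R})
    (xi_indep : mutually_independent xi)
    (xi_val : forall i w, `[0, 1]%classic (xi i w))
    (xi_unif : forall i (A : set R), measurable A ->
       distribution P (xi i) A = uniform_prob (@ltr01 R) A) :
  exists (g : R -> 'rV[R]_2 -> R) (delta : nat -> R),
    let Xi : set R := `[0, 1]%classic in
    let f (z : R) (x : 'rV[R]_2) : R :=
      Num.max (g z x) 0 + 35 * enorm x ^+ 2 in
    let D (nu : nat) : set 'rV[R]_2 :=
      [set x | segX x /\
               forall z, Xi z -> C1_on (eball x (delta nu)) (f z)] in
    let gap (nu : nat) (w : Omega) (y yh : 'rV[R]_2) : R :=
      enorm (mean_row P (fun w' => gradient (f (xi 0%N w')) y)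
             - nu%:R^-1 *: \sum_(1 <= i < nu.+1) gradient (f (xi i w)) yh) in
    [/\ caratheodory Xi g,
        [/\ forall nu, (0 < nu)%N -> 0 < delta nu <= 1,
            forall nu, (0 < nu)%N -> delta nu.+1 <= delta nu
          & delta @ \oo --> (0 : R)]
      & [/\ forall z, Xi z ->
              [/\ euclidean_lipschitz 70 setT (g z), euclidean_smooth 70 (g z),
                  convex_function setT (f z)
                & euclidean_lipschitz 140 (@segX R) (f z)],
            forall x, (`| 'E_P[fun w => f (xi 0%N w) x] | < +oo)%E,
            forall nu, (0 < nu)%N -> D nu !=set0
          & {ae P, forall w,
              ((2^-1)%:E <=
               limn_einf (fun nu : nat =>
                 ereal_sup [set
                   ereal_inf [set (gap nu w y yh)%:E
                     | y in eball x (delta nu) & yh in eball x (delta nu)]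
                   | x in D nu]))%E}]].
Proof.
exists (fun z => tilt (sign_of z)), (radius R) => Xi f D gap.
have nodeD nu k : (k <= depth nu)%N -> D nu (node R k).
  move=> knu; split; first exact: segX_node.
  move=> z _; apply: (@ridge_C1 R (sign_of z) (sign_of_le1 _) k
    (z \in cells (CodeSeq.decode k)) _ (radius_block R knu)).
  by [].
split.
- split; first by move=> z _; exact: tilt_continuous (sign_of_le1 _).
  by move=> x; exact: measurable_tilt_sign.
- split; last exact: radius_cvg0.
    by move=> nu _; have := radius_le R nu; rewrite radius_gt0/=; lra.
  by move=> nu _; exact: radius_mono.
split.
- move=> z _; have s1 := sign_of_le1 z; split.
  + move=> x y _ _; rewrite (le_trans (tilt_lipschitz s1 x y))//.
    by rewrite ler_wpM2r ?enorm_ge0// ler_nat.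
  + exact: tilt_smooth.
  + exact: ridge_convex.
  + exact: ridge_lipschitz.
- exact: expectation_ridge_lty.
- by move=> nu _; exists (node R 0); exact: nodeD.
(* The bound is proved for every [w], and for the supremum at each sample size [m >= 1]. *)
apply: aeW => w; rewrite limn_einf_lim.
apply: lime_ge; first exact: is_cvg_einfs.
exists 1%N => // n /= n0; apply: le_ereal_inf_tmp => _ [m /= nm <-].
have m0 : (0 < m)%N by exact: leq_trans nm.
have xi01 i : 0 <= xi i w <= 1 by have := xi_val i w; rewrite /= in_itv.
pose k := sample_code m (xi ^~ w); have km : (k <= depth m)%N := sample_code_depth _ _.
(* The witness is the midpoint of the block coding the observed sample, so it varies with [w]. *)
apply: le_ereal_sup_tmp; eexists; first by exists (node R k); [exact: nodeD|].
apply: le_ereal_inf_tmp => _ [y yk [yh yhk <-]]; rewrite lee_fin /gap.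
have rk := radius_block R km.
have mean := mean_gradient_ridge (xi_unif 0%N) rk yk.
have sample := sample_gradient_ridge m0 rk yhk (sample_code_hit xi01).
have coord0 v : eball (node R k) (radius R m) v -> `|v 0 0| <= radius R m.
  by move=> /(le_trans (coord_le_enorm _ 0)); rewrite !mxE/= subr0.
(* The first coordinate suffices: the empirical mean exceeds the expectation by at least
   [3 / 4 - 140 * radius R m], and the radius is at most 1/1000. *)
apply: le_trans (coord_le_enorm _ 0).
rewrite -normrN (le_trans _ (ler_norm _))// mxE [X in _ <= - (_ + X)]mxE sample.
have := coord0 _ yk; have := coord0 _ yhk.
rewrite !ler_norml => /andP[h1 h2] /andP[h3 h4].
move: (mean_row _ _ 0 0) mean => M mean.
have := radius_le R m; move: (radius R m) h1 h2 h3 h4 => r *; lra.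
Qed.
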